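(* Let $J$ be a finite set with $m:=|J|\ge 2$, let $\Pi=(P_x)_{x\in J}$ be a partition of a finite set $P$ of participants, let $\mathcal{Z}=(J,h,\boldsymbol g)$ be a uniform polymatroid with increment sequence $\boldsymbol g=(g_i)_{0\le i\le m}$ and $0<g_0<|P_z|$ for all $z\in J$, and let $\Delta\subseteq\mathcal{P}(J)\setminus\{\emptyset\}$ be a monotone increasing family such that $\min\Delta=\{\{x\}\}$ for a certain $x\in J$. (1) $\Delta$ is compatible with $\mathcal{Z}$ if and only if $g_{m-1}>0$. (2) Suppose $g_{m-1}>0$ and let $\Gamma=\Gamma(\Pi,\mathcal{Z},\Delta)$. Then (2a) if $g_0=g_{m-1}$, the hierarchical preorder induced by $\Gamma$ on $\Pi$ is of the type $Ord^*(J\setminus\{x\},\{x\})$; (2b) if $g_0>g_{m-1}$, the hierarchical order induced by $\Gamma$ on $\Pi$ is of the type $Ord(J\setminus\{x\},\{x\})$.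
   Context: Polymatroids. For a finite set $J$ let $\mathcal{P}(J)$ be its power set. An (integer) polymatroid is a pair $(J,h)$ with $h:\mathcal{P}(J)\to\mathbb{N}_0$ such that $h(\emptyset)=0$, $h(X)\le h(Y)$ if $X\subseteq Y$, and $h(X\cap Y)+h(X\cup Y)\le h(X)+h(Y)$. It is uniform if $h(X)=h(Y)$ whenever $|X|=|Y|$; write $h_i=h(X)$ for $|X|=i$. With $m=|J|$, its increment sequence is $\boldsymbol g=(g_0,\dots,g_m)$, $g_i=h_{i+1}-h_i$ for $0\le i\le m-1$ and $g_m=0$; it is a nonincreasing sequence of nonnegative integers, and $g_0>0$ is assumed. Such a polymatroid is written $\mathcal{Z}=(J,h,\boldsymbol g)$. Compatibility. A monotone increasing family $\Delta\subseteq\mathcal{P}(J)\setminus\{\emptyset\}$ is a nonempty family of nonempty subsets of $J$ closed under taking supersets in $J$; $\min\Delta$ is the set of its inclusion-minimal members. Fix $x_0\notin J$ and define $h'$ on $\mathcal{P}(J\cup\{x_0\})$ by $h'(X)=h(X)$ for $X\subseteq J$, $h'(X\cup\{x_0\})=h(X)$ if $X\in\Delta$, and $h'(X\cup\{x_0\})=h(X)+1$ if $X\subseteq J$, $X\notin\Delta$. $\Delta$ is compatible with $\mathcal{Z}$ if $h'$ is monotone increasing and submodular. Access structure. A partition $\Pi=(P_x)_{x\in J}$ of $P$ consists of pairwise disjoint nonempty sets (blocks) with union $P$. For $A\subseteq P$ put $\pi(A)=(|A\cap P_x|)_{x\in J}\in\mathbb{N}_0^J$. For $\bar v\in\mathbb{N}_0^J$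 and $Y\subseteq J$ put $\mathrm{supp}(\bar v)=\{x:v_x\ne0\}$, $|\bar v|=\sum_{x\in J}v_x$, $|\bar v_Y|=\sum_{x\in Y}v_x$. For $X\subseteq J$ let $\mathcal{B}(\mathcal{Z},X)=\{\bar v\in\mathbb{N}_0^J:\mathrm{supp}(\bar v)\subseteq X,\ |\bar v|=h(X),\ |\bar v_Y|\le h(Y)\text{ for all }Y\subseteq X\}$. For $\Delta$ compatible with $\mathcal{Z}$, $\Gamma(\Pi,\mathcal{Z},\Delta)$ is the family of all $A\subseteq P$ such that $\pi(A)\ge\bar v$ (coordinatewise) for some $\bar v\in\bigcup_{X\in\Delta}\mathcal{B}(\mathcal{Z},X)$. Hierarchy. For participants $p,q\in P$ write $q\preccurlyeq p$ if $A\cup\{p\}\in\Gamma$ for all $A\subseteq P\setminus\{p,q\}$ with $A\cup\{q\}\in\Gamma$. For blocks, $P_y\preccurlyeq P_x$ means $q\preccurlyeq p$ for some (equivalently, all) $q\in P_y$, $p\in P_x$; this is a preorder on $\Pi$. For disjoint $Y,X\subseteq J$, the preorder $\preccurlyeq$ on $\Pi$ is of type $Ord(Y,X)$ if for all $a,b\in J$: $P_b\preccurlyeq P_a$ if and only if ($a=b$) or ($b\in Y$ and $a\in X$). It is of type $Ord^*(Y,X)$ if for all $a,b\in J$: $P_b\preccurlyeq P_a$ if and only if ($a=b$) or ($a,b\in Y$) or ($b\in Y$ and $a\in X$). *)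

(* Defs.v *)
From mathcomp Require Import all_boot.

Set Implicit Arguments.
Unset Strict Implicit.
Unset Printing Implicit Defensive.

Section Polymatroids.

Variable J : finType.
Implicit Types (h : {set J} -> nat) (Delta : {set {set J}}).

Definition monotone_setfun h :=
  forall X Y : {set J}, X \subset Y -> h X <= h Y.

Definition submodular h :=
  forall X Y : {set J}, h (X :&: Y) + h (X :|: Y) <= h X + h Y.

Definition polymatroid h :=
  [/\ h set0 = 0, monotone_setfun h & submodular h].

Definition uniform h := forall X Y : {set J}, #|X| = #|Y| -> h X = h Y.

(* For a uniform polymatroid, h X and h Y below are h_i and h_(i+1) with
   i = #|X| < #|J|; the truncated subtraction is exact by monotonicity.
   Only the values g 0, ..., g #|J| are constrained. *)
Definition increment_sequence h (g : nat -> nat) :=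
  (forall X Y : {set J}, #|Y| = #|X|.+1 -> g #|X| = h Y - h X)
  /\ g #|J| = 0.

Definition monotone_family Delta :=
  [/\ Delta != set0, set0 \notin Delta &
      forall X Y : {set J}, X \in Delta -> X \subset Y -> Y \in Delta].

Definition min_family Delta : {set {set J}} :=
  [set X | minset (fun Y => Y \in Delta) X].

(* B(Z, X), as a predicate on vectors v *)
Definition bases h (X : {set J}) (v : {ffun J -> nat}) :=
  [/\ [set y | v y != 0] \subset X,
      \sum_y v y = h X &
      forall Y : {set J}, Y \subset X -> \sum_(y in Y) v y <= h Y].

End Polymatroids.

(* The function h' on subsets of J + x0: the extended ground set is option J,
   and x0 is None. *)
Definition extend (J : finType) (h : {set J} -> nat) (Delta : {set {set J}})
    (Z : {set option J}) : nat :=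
  let X := Some @^-1: Z in
  if None \in Z then (if X \in Delta then h X else h X + 1) else h X.

Definition compatible (J : finType) (h : {set J} -> nat)
    (Delta : {set {set J}}) :=
  monotone_setfun (extend h Delta) /\ submodular (extend h Delta).

Section AccessStructures.

Variables J P : finType.
Implicit Types (Pi : J -> {set P}) (Gamma : {set P} -> Prop).

Definition block_partition Pi :=
  [/\ forall x, Pi x != set0,
      forall x y, x != y -> [disjoint Pi x & Pi y] &
      \bigcup_x Pi x = [set: P]].

Definition profile Pi (A : {set P}) : {ffun J -> nat} :=
  [ffun x => #|A :&: Pi x|].

Definition access_structure Pi (h : {set J} -> nat) (Delta : {set {set J}})
    (A : {set P}) : Prop :=
  exists v : {ffun J -> nat},
    (exists2 X, X \in Delta & bases h X v)
    /\ (forall x, v x <= profile Pi A x).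

Definition participant_le Gamma (q p : P) :=
  forall A : {set P}, A \subset ~: [set p; q] ->
    Gamma (q |: A) -> Gamma (p |: A).

(* The preorder on blocks, transported to their indices. *)
Definition block_le Pi Gamma (y x : J) :=
  exists q p, [/\ q \in Pi y, p \in Pi x & participant_le Gamma q p].

End AccessStructures.

Section PreorderTypes.

Variable J : finType.
Implicit Types (le : J -> J -> Prop) (X Y : {set J}).

(* le b a stands for P_b <= P_a. *)
Definition type_Ord le Y X :=
  forall a b : J, le b a <-> (a = b \/ (b \in Y /\ a \in X)).

Definition type_Ord_star le Y X :=
  forall a b : J,
    le b a <-> [\/ a = b, a \in Y /\ b \in Y | b \in Y /\ a \in X].

End PreorderTypes.

(* Main.v *)
(* Delta consists of the sets containing x, and h X is the sum of the first
   |X| increments.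
   Replacing q in P_b by p in P_x: a base v that really used q is either
   shifted to v - e_b + e_x, or blocked by a tight set T containing x but not
   b; in the latter case v restricted to T is already a base below pi(A).
   x is not dominated by a: a profile (g_0 - 1) e_x + e_a carries no base,
   since every X in Delta other than {x} has h X > g_0.
   If g is constant, every base is at least g_0 at x, so that only the number
   of participants in P_x matters.
   Otherwise let k be minimal with g_k < g_0, let X of size k + 1 contain x and
   b, and let v be the base of X with v_x = g_k and value g_0 on the rest of X.
   Then v - e_b + e_a dominates no base of a set X' containing x. If
   |X'| <= k, the value at x would have to be g_0. If |X'| > k, comparing sums
   forces |X'| = k + 1 and the base to be v - e_b + e_a itself; its support
   contains both X and a, so X' = X contains a, where the value g_0 + 1 is too
   big. *)
Require Import Defs.
From mathcomp Require Import all_boot zify.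

Set Implicit Arguments.
Unset Strict Implicit.
Unset Printing Implicit Defensive.

(** * Auxiliary facts on finite sets and sums *)

Lemma exists_set_between (T : finType) (A C : {set T}) n :
  A \subset C -> #|A| <= n <= #|C| ->
  exists B : {set T}, [/\ A \subset B, B \subset C & #|B| = n].
Proof.
move=> sAC; elim: n => [|n IHn] /andP[leAn lenC].
  by exists A; split=> //; apply/eqP; rewrite -leqn0.
have [ltAn|geAn] := ltnP #|A| n.+1; last first.
  by exists A; split=> //; apply/eqP; rewrite eqn_leq leAn.
have [|B [sAB sBC cardB]] := IHn; first by rewrite -ltnS ltAn ltnW.
have /properP[_ [z zC zNB]] : B \proper C by rewrite properEcard sBC cardB.
exists (z |: B); split; last by rewrite cardsU1 zNB cardB.
  exact: subset_trans sAB (subsetUr _ _).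
by rewrite subUset sub1set zC.
Qed.

Lemma notin_pair (T : finType) (A : {set T}) p q :
  A \subset ~: [set p; q] -> p \notin A /\ q \notin A.
Proof. by rewrite subsetC subUset !sub1set !inE => /andP. Qed.

Lemma sum_pred1 (T : finType) (Q : pred T) (z : T) :
  \sum_(y | Q y) (y == z) = Q z.
Proof.
have [Qz|NQz] := boolP (Q z).
  by rewrite (bigD1 z)//= eqxx big1// => y /andP[_ /negPf->].
by rewrite big1// => y Qy; case: eqP Qy NQz => // -> ->.
Qed.

(** * Block partitions and profiles *)

Section Partitions.

Variables J P : finType.
Implicit Types (Pi : J -> {set P}) (A S : {set P}).

Lemma block_partition_inj Pi y z p :
  block_partition Pi -> p \in Pi y -> p \in Pi z -> y = z.
Proof.
case=> _ dis _ py pz; apply/eqP; apply: contraT => /dis /disjointFr /(_ py).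
by rewrite pz.
Qed.

Lemma profile_setU1 Pi A b q z :
  block_partition Pi -> q \in Pi b -> q \notin A ->
  profile Pi (q |: A) z = profile Pi A z + (z == b).
Proof.
move=> hPi qb qA; rewrite !ffunE setIUl.
have [->|zb] := eqVneq z b.
  by rewrite (setIidPl _) ?sub1set// cardsU1 inE (negPf qA) /= addnC.
rewrite [[set q] :&: _](_ : _ = set0) ?set0U ?addn0//.
apply/setP=> r; rewrite !inE; apply/negP=> /andP[/eqP-> qz].
by case/eqP: zb; apply: block_partition_inj qb.
Qed.

(** Pick [t y] elements of each block outside [S]; by disjointness the union of the choices meets
    each block only in its own choice. With [S] the pair of compared participants, this supplies the
    test sets that refute a comparison. *)
Lemma exists_profile Pi S (t : J -> nat) :
  block_partition Pi -> (forall y, t y <= #|Pi y :\: S|) ->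
  exists2 A : {set P}, A \subset ~: S & forall y, profile Pi A y = t y.
Proof.
move=> hPi tP.
have /fin_all_exists[F FP] y :
    exists B : {set P}, B \subset Pi y :\: S /\ #|B| = t y.
  have [|B [_ sB cB]] := exists_set_between (sub0set (Pi y :\: S)) (n := t y).
    by rewrite cards0 tP.
  by exists B.
exists (\bigcup_y F y).
  apply/bigcupsP=> y _; apply: subset_trans (proj1 (FP y)) _.
  by rewrite setDE subsetIr.
move=> y; rewrite ffunE -(proj2 (FP y)); congr #|pred_of_set _|.
have sF z : F z \subset Pi z.
  exact: subset_trans (proj1 (FP z)) (subsetDl _ _).
apply/setP=> r; rewrite inE; apply/andP/idP=> [[/bigcupP[z _ rz] ry]|ry].
  by rewrite (block_partition_inj hPi ry (subsetP (sF z) _ rz)).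
by split; [apply/bigcupP; exists y | apply: (subsetP (sF y))].
Qed.

Lemma block_le_refl Pi (Gamma : {set P} -> Prop) a :
  block_partition Pi -> block_le Pi Gamma a a.
Proof. by case=> /(_ a)/set0Pn[q qa] _ _; exists q, q; split. Qed.

End Partitions.

(** * Bases and their restriction to tight sets *)

Section Bases.

Variables (J : finType) (h : {set J} -> nat).
Implicit Types (X Y T : {set J}) (v : {ffun J -> nat}).

Lemma bases_out X v y : bases h X v -> y \notin X -> v y = 0.
Proof.
case=> /subsetP sX _ _; apply: contraNeq => vy; apply: sX.
by rewrite inE.
Qed.

Lemma bases_sum X v : bases h X v -> \sum_(y in X) v y = h X.
Proof.
move=> vX; have [_ <- _] := vX; rewrite (bigID [in X] predT)/=.
by rewrite [X in _ + X]big1 ?addn0// => y; apply: bases_out.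
Qed.

(** The constraints for subsets of [T] are among those for [X], and tightness on [T] supplies the
    total. *)
Lemma bases_restrict X T v :
  T \subset X -> bases h X v -> \sum_(y in T) v y = h T ->
  bases h T [ffun y => if y \in T then v y else 0].
Proof.
move=> sTX [_ _ vle] vT; split.
- by apply/subsetP=> y; rewrite inE ffunE; case: ifP.
- by under eq_bigr do rewrite ffunE; rewrite -big_mkcond.
- move=> Y sYT; rewrite (eq_bigr v) ?vle ?(subset_trans sYT)//.
  by move=> y /(subsetP sYT) yT; rewrite ffunE yT.
Qed.

End Bases.

(** * Increments of a uniform polymatroid *)

Section UniformPolymatroid.

Variables (J : finType) (h : {set J} -> nat) (g : nat -> nat).
Hypotheses (hpoly : polymatroid h)
           (hg : increment_sequence h g).
Implicit Types X Y : {set J}.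

Lemma uniformE X : h X = \sum_(i < #|X|) g i.
Proof.
have [h0 hm _] := hpoly; have [hgE _] := hg.
move en: #|X| => n; elim: n X en => [|n IHn] X en.
  by rewrite (cards0_eq en) h0 big_ord0.
have [z zX] : exists z, z \in X by apply/set0Pn; rewrite -card_gt0 en.
have cz : #|X :\ z| = n by move: en; rewrite (cardsD1 z) zX => -[].
rewrite big_ord_recr /= -(IHn _ cz) -cz (hgE _ X) ?cz//.
by rewrite subnKC// hm// subD1set.
Qed.

Lemma uniform_set1 z : h [set z] = g 0.
Proof. by rewrite uniformE cards1 big_ord1. Qed.

Lemma uniform_incr X Y : #|X| < #|Y| -> h X + g #|X| <= h Y.
Proof.
move=> ltXY; rewrite !uniformE.
have -> : \sum_(i < #|X|) g i + g #|X| = \sum_(i < #|X|.+1) g i.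
  by rewrite big_ord_recr.
rewrite -!(big_mkord xpredT g).
by rewrite (big_cat_nat (leq0n #|X|.+1) ltXY) leq_addr.
Qed.

(** One step is submodularity for [B :\ z] and [B :\ y] with [#|B| = j.+2]: both have size [j.+1],
    their intersection has size [j] and their union is [B]. *)
Lemma increments_nonincreasing i j : i <= j < #|J| -> g j <= g i.
Proof.
case/andP; elim: j => [|j IHj]; first by rewrite leqn0 => /eqP->.
rewrite leq_eqVlt => /predU1P[->//|leij ltjJ].
apply: leq_trans (IHj leij (ltnW ltjJ)).
have [|B [_ _ cB]] := exists_set_between (sub0set [set: J]) (n := j.+2).
  by rewrite cards0 cardsT ltjJ.
have [z zB] : exists z, z \in B by apply/set0Pn; rewrite -card_gt0 cB.
have cz : #|B :\ z| = j.+1 by move: cB; rewrite (cardsD1 z) zB => -[].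
have [y yB] : exists y, y \in B :\ z by apply/set0Pn; rewrite -card_gt0 cz.
have cyz : #|B :\ z :\ y| = j by move: cz; rewrite (cardsD1 y) yB => -[].
have /andP[nyz yB'] : (y != z) && (y \in B) by move: yB; rewrite in_setD1.
have cy : #|B :\ y| = j.+1 by move: cB; rewrite (cardsD1 y) yB' => -[].
have [_ _ /(_ (B :\ z) (B :\ y))] := hpoly.
have -> : (B :\ z) :&: (B :\ y) = B :\ z :\ y.
  apply/setP=> r; rewrite !inE.
  by case: (r == z); case: (r == y); case: (r \in B).
have -> : (B :\ z) :|: (B :\ y) = B.
  apply/setP=> r; rewrite !inE; have [->|_] := eqVneq r z.
    by rewrite eq_sym nyz.
  by case: (r \in B); rewrite ?andbF.
rewrite !uniformE cz cy cyz cB !big_ord_recr /=; lia.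
Qed.

Hypothesis g_gt0 : 0 < g #|J|.-1.

(** The increment [g #|X|] is at least the last one, which is positive. *)
Lemma uniform_strict X Y : #|X| < #|Y| -> h X < h Y.
Proof.
move=> ltXY; apply: leq_trans (uniform_incr ltXY).
rewrite -addn1 leq_add2l (leq_trans g_gt0)// increments_nonincreasing//.
by have := max_card Y; rewrite -[#|{: J}|]/(#|J|); lia.
Qed.

End UniformPolymatroid.

(** * Compatibility of a family generated by one singleton *)

Lemma min_family_set1 (J : finType) (Delta : {set {set J}}) (x : J) :
  monotone_family Delta -> min_family Delta = [set [set x]] ->
  forall X, (X \in Delta) = (x \in X).
Proof.
case=> _ _ up minE X; apply/idP/idP=> [XD|xX].
  have [Y minY sYX] := @minset_exists _ (fun Y => Y \in Delta) X XD.
  have : Y \in min_family Delta by rewrite inE.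
  by rewrite minE inE => /eqP YE; move: sYX; rewrite YE sub1set.
apply: (up [set x]); last by rewrite sub1set.
have : [set x] \in min_family Delta by rewrite minE inE.
by rewrite inE => /minsetp.
Qed.

Section PrincipalFamily.

Variables (J : finType) (h : {set J} -> nat) (g : nat -> nat).
Variables (Delta : {set {set J}}) (x : J).
Hypotheses (hJ : 2 <= #|J|) (hpoly : polymatroid h)
           (hg : increment_sequence h g)
           (DeltaE : forall X, (X \in Delta) = (x \in X)).

Lemma extendE (Z : {set option J}) :
  extend h Delta Z =
  h (Some @^-1: Z) + ((None \in Z) && (Some x \notin Z)).
Proof.
rewrite /extend DeltaE inE; case: ifP => _; case: (_ \in _) => //=;
  exact: esym (addn0 _).
Qed.

Lemma compatible_principal : compatible h Delta <-> 0 < g #|J|.-1.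
Proof.
have [_ hm hs] := hpoly; split=> [[mono _]|g_gt0].
  (* Test monotonicity between everything but [x] and the whole extended set: the extra 1
     disappears, so the last increment must make up for it. *)
  have := mono (None |: [set Some y | y in [set~ x]]) setT (subsetT _).
  have c1 : #|[set~ x]| = #|J|.-1 by rewrite cardsC1.
  have [hgE _] := hg; rewrite -c1 (hgE _ setT); last first.
    by rewrite c1 cardsT prednK// ltnW.
  rewrite !extendE !inE /=.
  have -> : Some @^-1: (None |: [set Some y | y in [set~ x]]) = [set~ x].
    apply/setP=> y; rewrite !inE /= mem_imset ?inE//; exact: Some_inj.
  rewrite mem_imset; last exact: Some_inj.
  rewrite !inE eqxx /= preimsetT; lia.
have mpre (Z W : {set option J}) :
    Z \subset W -> Some @^-1: Z \subset Some @^-1: W.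
  exact: preimsetS.
split=> Z W; rewrite !extendE.
  move=> sZW; have := hm _ _ (mpre _ _ sZW).
  have [NZ|//] := boolP (None \in Z); last by move=> _; rewrite addn0; lia.
  rewrite (subsetP sZW _ NZ) /=.
  have [xW|xW] := boolP (Some x \in W); last first.
    by rewrite (contra (subsetP sZW (Some x)) xW); lia.
  have [xZ|xZ] := boolP (Some x \in Z); first by lia.
  (* Here [x] enters on passing to [W], so the extra 1 of [Z] is lost; strict growth of [h] pays for
     it. *)
  have : #|Some @^-1: Z| < #|Some @^-1: W|.
    apply: proper_card; rewrite properE mpre//=; apply/subsetPn.
    by exists x; rewrite inE.
  by move/(uniform_strict hpoly hg g_gt0) => lt _; rewrite addn1 addn0.
(* Besides [h] only the indicator of containing [None] but not [Some x] remains. It is a directed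
   cut function, hence submodular, as the cases confirm. *)
have := hs (Some @^-1: Z) (Some @^-1: W).
rewrite -preimsetI -preimsetU !inE.
move: (h _) (h _) (h _) (h _) => hI hU hZ hW.
case: (None \in Z); case: (None \in W);
  case: (Some x \in Z); case: (Some x \in W) => /=; lia.
Qed.

(** * Comparison of blocks *)

Variables (P : finType) (Pi : J -> {set P}).
Hypotheses (hPi : block_partition Pi) (hg0 : forall z, 0 < g 0 < #|Pi z|)
           (g_gt0 : 0 < g #|J|.-1).

Let Gamma := access_structure Pi h Delta.

(** Since [p] and [q] lie in different blocks, each block loses at most one element, and it had more
    than [g 0]. *)
Lemma leq_card_setD2 a b p q y :
  a != b -> q \in Pi b -> p \in Pi a -> g 0 <= #|Pi y :\: [set p; q]|.
Proof.
move=> nab qb pa; have /andP[_ lt0] := hg0 y.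
rewrite -ltnS; apply: leq_trans lt0 _.
rewrite -(cardsID [set p; q] (Pi y)) -addn1 addnC leq_add2l.
rewrite -(cards1 (if y == a then p else q)) subset_leq_card//.
apply/subsetP=> r; rewrite !inE => /andP[ry /orP[]/eqP rE];
  move: ry; rewrite rE.
  by move/(block_partition_inj hPi pa) ->; rewrite eqxx.
by move/(block_partition_inj hPi qb) <-; rewrite [b == a]eq_sym (negPf nab).
Qed.

Lemma block_le_principal b : b != x -> block_le Pi Gamma b x.
Proof.
move=> nbx; have [/(_ _)/set0Pn ne _ _] := hPi.
have [[q qb] [p px]] := (ne b, ne x); exists q, p; split=> // A.
move=> /notin_pair[pA qA] [v [[X XD vX] vA]].
have xX : x \in X by rewrite -DeltaE.
have [_ vsum vle] := vX.
have [|vbA] := leqP (v b) (profile Pi A b).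
  move=> vbA; exists v; split; first by exists X.
  move=> y; have := vA y.
  rewrite (profile_setU1 _ hPi qb qA) (profile_setU1 _ hPi px pA).
  by have [->|_] := eqVneq y b; [move: vbA|]; clear; lia.
have vbE : v b = (profile Pi A b).+1.
  have := vA b; rewrite (profile_setU1 _ hPi qb qA) eqxx.
  by move: vbA; clear; lia.
have bX : b \in X by apply: contraT => /(bases_out vX); rewrite vbE.
have [/existsP[T /and4P[sTX xT bT /eqP vT]]|tight] := boolP [exists T : {set J},
    [&& T \subset X, x \in T, b \notin T & \sum_(y in T) v y == h T]].
  exists [ffun y => if y \in T then v y else 0]; split.
    by exists T; [rewrite DeltaE | apply: bases_restrict vX vT].
  move=> y; rewrite ffunE; case: ifP => // yT.
  have := vA y; rewrite (profile_setU1 _ hPi qb qA) (profile_setU1 _ hPi px pA).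
  rewrite (_ : (y == b) = false); first by clear; lia.
  by apply: contraNF bT => /eqP <-.
(* No tight set blocks the shift. The truncated subtraction is exact because [v b] is positive. *)
pose w := [ffun y => (v y - (y == b)) + (y == x)].
have wsum (Y : {set J}) :
    \sum_(y in Y) w y + (b \in Y) = \sum_(y in Y) v y + (x \in Y).
  rewrite -!(sum_pred1 [in Y]) -!big_split /=; apply: eq_bigr => y _.
  by rewrite ffunE; have [->|_] := eqVneq y b; rewrite ?vbE; clear; lia.
exists w; split; last first.
  move=> y; have := vA y.
  rewrite (profile_setU1 _ hPi qb qA) (profile_setU1 _ hPi px pA) [w y]ffunE.
  by have [->|_] := eqVneq y b; rewrite ?vbE; clear; lia.
exists X => //; split.
- apply/subsetP=> y; rewrite inE ffunE; apply: contraNT => yX.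
  rewrite (bases_out vX yX) sub0n add0n.
  by have [yx|//] := eqVneq y x; rewrite yx xX in yX.
- have sumT (f : J -> nat) : \sum_(y in [set: J]) f y = \sum_y f y.
    by apply: eq_bigl => y; rewrite inE.
  by have := wsum setT; rewrite !inE -vsum !sumT => /addIn.
(* The sum grows only if [Y] contains [x] but not [b]; such a [Y] is not tight, so there is room for
   1. *)
- move=> Y sYX; have := wsum Y; have := vle _ sYX.
  move: tight; rewrite negb_exists => /forallP/(_ Y); rewrite sYX /=.
  by case: (x \in Y); case: (b \in Y) => //=; clear; lia.
Qed.

Lemma bases_set1 z : bases h [set z] [ffun y => if y == z then g 0 else 0].
Proof.
split.
- by apply/subsetP=> y; rewrite !inE ffunE; case: ifP.
- under eq_bigr do rewrite ffunE.
  by rewrite -big_mkcond big_pred1_eq (uniform_set1 hpoly hg).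
- move=> Y; rewrite subset1 => /orP[]/eqP->.
    by rewrite big_set1 ffunE eqxx (uniform_set1 hpoly hg).
  by rewrite big_set0.
Qed.

Lemma not_block_le_principal a : a != x -> ~ block_le Pi Gamma x a.
Proof.
move=> nax [q [p [qx pa le]]].
have /andP[g0_gt0 _] := hg0 x.
(* [A] is one participant short of [g 0] in the block of [x]: adding [q] completes a base of
   [[set x]]. *)
have [y|A sA tA] := @exists_profile _ _ Pi [set p; q]
    (fun y => if y == x then (g 0).-1 else 0) hPi.
  apply: leq_trans (leq_card_setD2 y nax qx pa).
  by case: ifP => // _; rewrite leq_pred.
have [pA qA] := notin_pair sA.
have [|v [[X XD vX] vA]] := le A sA.
  exists [ffun y => if y == x then g 0 else 0]; split.
    by exists [set x]; [rewrite DeltaE inE | apply: bases_set1].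
  move=> y; rewrite ffunE (profile_setU1 _ hPi qx qA) tA.
  by case: eqP => _; move: g0_gt0; clear; lia.
have xX : x \in X by rewrite -DeltaE.
have {}vA y : v y <= (if y == x then (g 0).-1 else 0) + (y == a).
  by rewrite -tA -(profile_setU1 _ hPi pa pA).
have [X1|X2] := leqP #|X| 1.
  have XE : X = [set x] by apply/esym/eqP; rewrite eqEcard sub1set xX cards1.
  have := bases_sum vX; rewrite XE big_set1 (uniform_set1 hpoly hg).
  by have := vA x; rewrite eqxx eq_sym (negPf nax); move: g0_gt0; clear; lia.
have := @uniform_strict _ _ _ hpoly hg g_gt0 [set x] X.
rewrite cards1 (uniform_set1 hpoly hg) => /(_ X2).
have [_ <- _] := vX; apply/negP; rewrite -leqNgt.
apply: leq_trans; first by apply: leq_sum => y _; apply: vA.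
rewrite big_split /= -big_mkcond big_pred1_eq sum_pred1.
by move: g0_gt0; clear; lia.
Qed.

Lemma block_le_constant a b :
  g 0 = g #|J|.-1 -> a != x -> b != x -> block_le Pi Gamma b a.
Proof.
move=> gc nax nbx; have [/(_ _)/set0Pn ne _ _] := hPi.
have [[q qb] [p pa]] := (ne b, ne a); exists q, p; split=> // A.
move=> /notin_pair[pA qA] [v [[X XD vX] vA]].
have xX : x \in X by rewrite -DeltaE.
have hE (Y : {set J}) : h Y = #|Y| * g 0.
  rewrite (uniformE hpoly hg) (eq_bigr (fun=> g 0)).
    by rewrite sum_nat_const card_ord.
  move=> i _; have ltiJ : i < #|J| by apply: leq_trans (ltn_ord i) (max_card _).
  apply/eqP; rewrite eqn_leq (increments_nonincreasing hpoly hg)//=.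
  by rewrite gc (increments_nonincreasing hpoly hg)//; move: ltiJ; clear; lia.
(* The total over [X] is [#|X| * g 0], while the part off [x] is at most [(#|X| - 1) * g 0]. *)
have vx : v x >= g 0.
  have := bases_sum vX; rewrite (big_setD1 x)//= hE (cardsD1 x) xX.
  have [_ _ /(_ _ (subD1set X x))] := vX; rewrite hE; clear; lia.
exists [ffun y => if y == x then g 0 else 0]; split.
  by exists [set x]; [rewrite DeltaE inE | apply: bases_set1].
move=> y; rewrite ffunE; case: eqP => // ->.
have := vA x; rewrite (profile_setU1 _ hPi qb qA) (profile_setU1 _ hPi pa pA).
rewrite ![x == _]eq_sym (negPf nax) (negPf nbx).
by rewrite !addn0; apply: leq_trans.
Qed.

Lemma not_block_le_nonconstant a b :
  g #|J|.-1 < g 0 -> a != x -> b != x -> a != b -> ~ block_le Pi Gamma b a.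
Proof.
move=> gn nax nbx nab [q [p [qb pa le]]].
have ex_k : exists k, g k < g 0 by exists #|J|.-1.
case: (ex_minnP ex_k) => k gk mink.
have ltkJ : k < #|J| by have := mink _ gn; move: hJ; clear; lia.
have k_gt0 : 0 < k by rewrite lt0n; apply: contraTneq gk => ->; rewrite ltnn.
have noninc := increments_nonincreasing hpoly hg.
have gk_gt0 : 0 < g k.
  by apply: leq_trans g_gt0 (noninc _ _ _); move: ltkJ; clear; lia.
have gE i : i < k -> g i = g 0.
  move=> ltik; apply/eqP; rewrite eqn_leq noninc ?(ltn_trans ltik)//=.
  by rewrite leqNgt; apply: contraL ltik => /mink; rewrite -leqNgt.
have hE (Y : {set J}) : #|Y| <= k -> h Y = #|Y| * g 0.
  move=> leYk; rewrite (uniformE hpoly hg).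
  rewrite (eq_bigr (fun=> g 0)) ?sum_nat_const ?card_ord// => i _.
  by apply: gE; apply: leq_trans leYk.
have hE1 (Y : {set J}) : #|Y| = k.+1 -> h Y = k * g 0 + g k.
  move=> cY; rewrite (uniformE hpoly hg) cY big_ord_recr /=.
  by rewrite (eq_bigr (fun=> g 0)) ?sum_nat_const ?card_ord// => i _; apply: gE.
have [|X [sX _ cX]] := exists_set_between (subsetT [set x; b]) (n := k.+1).
  by rewrite cards2 cardsT eq_sym nbx; move: k_gt0 ltkJ; clear; lia.
have [xX bX] : x \in X /\ b \in X.
  by move: sX; rewrite subUset !sub1set => /andP.
pose v := [ffun y => if y == x then g k else if y \in X then g 0 else 0].
have vsum (Y : {set J}) : Y \subset X ->
    \sum_(y in Y) v y = (x \in Y) * g k + #|Y :\ x| * g 0.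
  move=> sYX.
  have sumD : \sum_(y in Y :\ x) v y = #|Y :\ x| * g 0.
    rewrite -sum_nat_const; apply: eq_bigr => y; rewrite !inE ffunE.
    by case/andP=> /negPf-> /(subsetP sYX)->.
  have [xY|xY] := boolP (x \in Y).
    by rewrite (big_setD1 x)//= sumD ffunE eqxx mul1n.
  by rewrite -sumD; have /setDidPl-> : [disjoint Y & [set x]]
    by rewrite disjoint_sym disjoints1.
have sumX : (x \in X) * g k + #|X :\ x| * g 0 = h X.
  move: (cX); rewrite hE1// (cardsD1 x) xX mul1n add1n => -[->].
  exact: addnC.
have vX : bases h X v.
  split.
  - apply/subsetP=> y; rewrite inE ffunE.
    by have [->//|_] := eqVneq y x; case: ifP.
  - rewrite (bigID [in X] predT)/= [X in _ + X]big1 ?addn0; last first.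
      move=> y yX; rewrite ffunE (negPf yX).
      by have [yx|//] := eqVneq y x; rewrite yx xX in yX.
    by rewrite vsum// sumX.
  - move=> Y sYX; rewrite vsum//.
    (* A proper subset has at most [k] elements, so its bound is [#|Y| * g 0], and no value of [v]
       exceeds [g 0]. *)
    have [->|neqYX] := eqVneq Y X; first by rewrite sumX.
    have leYk : #|Y| <= k.
      by rewrite -ltnS -cX proper_card// properEneq neqYX.
    rewrite hE// (cardsD1 x Y) mulnDl leq_add2r leq_mul2l (ltnW gk).
    exact: orbT.
have g0_gt1 : 1 < g 0 by apply: leq_ltn_trans gk.
(* The profile of [A] is [v] minus one at [b], so adding [q] restores [v]. *)
have [y|A sA tA] := @exists_profile _ _ Pi [set p; q]
    (fun y => v y - (y == b)) hPi.
  apply: leq_trans (leq_card_setD2 y nab qb pa); rewrite ffunE.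
  by case: (y == x); case: (y \in X); move: gk; clear; lia.
have [pA qA] := notin_pair sA.
have [|u [[Z ZD uZ] uA]] := le A sA.
  exists v; split; first by exists X; rewrite ?DeltaE.
  by move=> y; rewrite (profile_setU1 _ hPi qb qA) tA; clear; lia.
have xZ : x \in Z by rewrite -DeltaE.
pose w y := (v y - (y == b)) + (y == a).
have {}uA y : u y <= w y by rewrite /w -tA -(profile_setU1 _ hPi pa pA).
have vb : v b = g 0 by rewrite ffunE (negPf nbx) bX.
have [_ usum ule] := uZ.
(* For small [Z] the rank is [#|Z| * g 0], forcing [u x] to be at least [g 0]; but [w x] is only
   [g k]. *)
have [leZk|ltkZ] := leqP #|Z| k.
  have := bases_sum uZ; rewrite (big_setD1 x)//=.
  have := ule _ (subD1set Z x); have := uA x.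
  rewrite /w ffunE eqxx eq_sym (negPf nbx) eq_sym (negPf nax) subn0 addn0.
  rewrite !hE//; last first.
    by rewrite (leq_trans _ leZk)// subset_leq_card// subD1set.
  by rewrite (cardsD1 x Z) xZ; move: gk; clear; nia.
have wsum : \sum_y w y = h X.
  have [_ <- _] := vX; rewrite /w big_split /= sum_pred1.
  rewrite (bigD1 b) //= [in RHS](bigD1 b) //= eqxx vb.
  rewrite (eq_bigr v) => [|y /negPf->]; last exact: subn0.
  by rewrite subn1 addn1 -addSn prednK// ltnW.
(* A larger [Z] would have rank above [h X], which is the total of [w]. *)
have cZ : #|Z| = k.+1.
  apply/eqP; rewrite eqn_leq ltkZ andbT leqNgt; apply/negP=> ltZ.
  have := @uniform_strict _ _ _ hpoly hg g_gt0 X Z.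
  rewrite cX => /(_ ltZ); rewrite -usum -wsum; apply/negP; rewrite -leqNgt.
  exact: leq_sum.
(* A termwise inequality with equal totals is an equality. *)
have uE y : u y = w y.
  have [_] := leqif_sum (fun y (_ : predT y) => leqif_eq (uA y)).
  rewrite usum wsum (hE1 _ cX) (hE1 _ cZ) eqxx => /esym/forallP/(_ y).
  by move/eqP.
have wZ y : 0 < w y -> y \in Z.
  by rewrite -uE; apply: contraTT => /(bases_out uZ)->.
have sXZ : X \subset Z.
  (* Removing one at [b] leaves a positive value because [g 0 > 1], and the value at [x] is
     [g k > 0]. *)
  apply/subsetP=> y yX; apply: wZ; rewrite /w ffunE yX.
  by have [->|_] := eqVneq y x; rewrite ?[x == b]eq_sym ?(negPf nbx);
    move: gk_gt0 g0_gt1; clear; lia.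
have XZ : X = Z by apply/eqP; rewrite eqEcard sXZ cX cZ /=.
have aZ : a \in Z by apply: wZ; rewrite /w eqxx addn1.
have := ule [set a]; rewrite sub1set aZ => /(_ isT).
rewrite big_set1 (uniform_set1 hpoly hg) uE /w ffunE (negPf nax) XZ aZ.
by rewrite eqxx (negPf nab); clear; lia.
Qed.

End PrincipalFamily.

(** * Compatibility criterion and type of the preorder *)

Theorem theorem4p11 (J P : finType) (Pi : J -> {set P})
  (h : {set J} -> nat) (g : nat -> nat) (Delta : {set {set J}}) (x : J)
  (hJ : 2 <= #|J|)
  (hPi : block_partition Pi)
  (hpoly : polymatroid h)
  (hunif : uniform h)
  (hg : increment_sequence h g)
  (hg0 : forall z : J, 0 < g 0 < #|Pi z|)
  (hDelta : monotone_family Delta)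
  (hmin : min_family Delta = [set [set x]]) :
  (compatible h Delta <-> 0 < g #|J|.-1)
  /\ (0 < g #|J|.-1 ->
      let Gamma := access_structure Pi h Delta in
      (g 0 = g #|J|.-1 ->
         type_Ord_star (block_le Pi Gamma) (~: [set x]) [set x])
      /\ (g #|J|.-1 < g 0 ->
         type_Ord (block_le Pi Gamma) (~: [set x]) [set x])).
Proof.
have DeltaE := min_family_set1 hDelta hmin.
split; first exact: compatible_principal.
move=> g_gt0 Gamma; split=> gc a b; rewrite !inE.
  split=> [le|].
    have [ax|ax] := eqVneq a x.
      have [bx|bx] := eqVneq b x; last by constructor 3.
      by constructor 1; rewrite ax bx.
    have [bx|bx] := eqVneq b x; last by constructor 2.
    by exfalso; move: le; rewrite bx; apply: (not_block_le_principal hpoly hg).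
  case=> [->|[ax bx]|[bx /eqP->]].
  - exact: block_le_refl.
  - exact: (block_le_constant hpoly hg).
  - exact: block_le_principal.
split=> [le|]; last first.
  case=> [->|[bx /eqP->]]; first exact: block_le_refl.
  exact: block_le_principal.
have [->|ab] := eqVneq a b; first by left.
have [ax|ax] := eqVneq a x; first by right; rewrite -ax eq_sym.
have [bx|bx] := eqVneq b x.
  by exfalso; move: le; rewrite bx; apply: (not_block_le_principal hpoly hg).
by exfalso; move: le; apply: (not_block_le_nonconstant hJ hpoly hg).
Qed.
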